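(* Let $(A,\mathfrak{m})$ be a Noetherian local ring and let $\mathfrak{a}$ be an ideal of $A$. Let $M$ be a finitely generated $A$-module and let $\mathcal{G}$ be an $\mathfrak{a}$-stable filtration on $M$. Then there exists an $\mathfrak{a}$-stable filtration $\mathcal{H}$ on $M^*=\operatorname{Hom}_A(M,A)$ such that $$\mathcal{R}(\mathcal{H},M^* )\cong {}^*\operatorname{Hom}_{\mathcal{R}_{\mathfrak{a}}(A)}\big(\mathcal{R}(\mathcal{G},M),\mathcal{R}_{\mathfrak{a}}(A)\big)$$ as graded $\mathcal{R}_{\mathfrak{a}}(A)$-modules.
   Context: An $\mathfrak{a}$-filtration on a finitely generated $A$-module $M$ is a family $\mathcal{G}=\{M_n\}_{n\in\mathbb{Z}}$ of submodules of $M$ with $M_n\supseteq M_{n+1}$ for all $n$, $M_n=M$ for all $n\ll 0$, and $\mathfrak{a}M_n\subseteq M_{n+1}$ for all $n$. It is $\mathfrak{a}$-stable if moreover $\mathfrak{a}M_n=M_{n+1}$ for all $n\gg 0$. $\mathcal{R}_{\mathfrak{a}}(A)=\bigoplus_{n\in\mathbb{Z}}\mathfrak{a}^n t^n=A[\mathfrak{a}t,t^{-1}]$ (with $\mathfrak{a}^n=A$ for $n\le 0$) is the extended Rees algebra of $A$ with respect to $\mathfrak{a}$. $\mathcal{R}(\mathcal{G},M)=\bigoplus_{n\in\mathbb{Z}}M_n t^n$ is the extended Rees module of $M$ with respect to $\mathcal{G}$; it is a finitely generated graded $\mathcal{R}_{\mathfrak{a}}(A)$-module. For graded modules $U,V$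 over a graded ring $R$, ${}^*\operatorname{Hom}_R(U,V)$ is the graded $R$-module whose degree $c$ component consists of the homogeneous $R$-linear maps $U\to V$ of degree $c$. *)

(* Defs.v *)
From HB Require Import structures.
From mathcomp Require Import all_boot all_order all_algebra.
From mathcomp Require Import finmap.
From mathcomp Require Import all_classical.

Set Implicit Arguments.
Unset Strict Implicit.
Unset Printing Implicit Defensive.

Import GRing.Theory.

Local Open Scope classical_set_scope.
Local Open Scope ring_scope.

(* Ideals of a commutative ring [A] are the submodules of [A] over itself; the
   unit ideal is allowed.  Membership predicates are boolean, which is no
   restriction in the presence of the axioms of [boolp]. *)
Notation ideal A := (submodClosed A^o).

Section Commutative_algebra.
Variable A : comNzRingType.

Definition fingen_sub (M : lmodType A) (N : {pred M}) : Prop :=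
  exists s : seq M, forall x : M,
    x \in N <-> exists c : 'I_(size s) -> A, x = \sum_i c i *: s`_i.

Definition fingen (M : lmodType A) : Prop := @fingen_sub M predT.

Definition noetherian : Prop := forall I : ideal A, fingen_sub I.

Definition maximal_ideal (m : ideal A) : Prop :=
  (1 : A^o) \notin m /\
  forall I : ideal A,
    {subset m <= I} -> (1 : A^o) \notin I -> I =i m.

Definition local_ring (m : ideal A) : Prop :=
  maximal_ideal m /\ forall m' : ideal A, maximal_ideal m' -> m' =i m.

Definition ideal_mul (M : lmodType A) (a : {pred A^o}) (N : {pred M})
    : {pred M} :=
  [pred x | `[< exists s : seq (A * M),
      (forall p, p \in s -> (p.1 : A^o) \in a /\ p.2 \in N) /\
      x = \sum_(p <- s) p.1 *: p.2 >] ].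

Lemma ideal_mulP (M : lmodType A) (a : {pred A^o}) (N : {pred M}) x :
  reflect (exists s : seq (A * M),
      (forall p, p \in s -> (p.1 : A^o) \in a /\ p.2 \in N) /\
      x = \sum_(p <- s) p.1 *: p.2) (x \in ideal_mul a N).
Proof. by rewrite inE; apply: asboolP. Qed.

Lemma ideal_mul_sub (M : lmodType A) (a : {pred A^o}) (N P : {pred M}) :
  submod_closed P ->
  (forall r x, (r : A^o) \in a -> x \in N -> r *: x \in P) ->
  {subset ideal_mul a N <= P}.
Proof.
move=> clP aNP x /ideal_mulP [s [sP ->]].
have [P0 PL] := clP.
elim: s sP => [|p s IHs] sP; first by rewrite big_nil.
rewrite big_cons -[p.1 *: p.2]scale1r; apply: PL.
  by have [? ?] := sP p (mem_head _ _); apply: aNP.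
by apply: IHs => q qs; apply: sP; rewrite inE qs orbT.
Qed.

Lemma mem_ideal_mul (M : lmodType A) (a : {pred A^o}) (N : {pred M}) r x :
  (r : A^o) \in a -> x \in N -> r *: x \in ideal_mul a N.
Proof.
move=> ra xN; apply/ideal_mulP; exists [:: (r, x)]; rewrite big_seq1.
by split=> // p; rewrite inE => /eqP ->.
Qed.

Lemma ideal_mul_submod (M : lmodType A) (a : ideal A) (N : {pred M}) :
  submod_closed (ideal_mul a N).
Proof.
split; first by apply/ideal_mulP; exists [::]; rewrite big_nil.
move=> c x y /ideal_mulP [s [sP ->]] /ideal_mulP [t [tP ->]].
apply/ideal_mulP; exists ([seq (c * p.1, p.2) | p <- s] ++ t); split.
  move=> p; rewrite mem_cat => /orP [/mapP [q qs ->]|/tP //] /=.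
  by have [qa qN] := sP q qs; split=> //; apply: (@rpredZ _ _ a c q.1).
rewrite big_cat big_map scaler_sumr; congr (_ + _).
by apply: eq_bigr => p _; rewrite scalerA.
Qed.

Fixpoint ideal_pow (a : {pred A^o}) (n : nat) : {pred A^o} :=
  if n is k.+1 then ideal_mul a (ideal_pow a k) else predT.

End Commutative_algebra.

Section Filtrations.
Variables (A : comNzRingType) (a : ideal A).

Record filtration (M : lmodType A) := Filtration {
  fil :> int -> {pred M};
  fil_submod : forall n, submod_closed (fil n);
  fil_dec : forall n : int, {subset fil (n + 1) <= fil n};
  fil_exhaustive : exists n0 : int, forall n : int, n <= n0 -> fil n =i predT;
  fil_mul : forall n, {subset ideal_mul a (fil n) <= fil (n + 1)}
}.

Definition stable (M : lmodType A) (G : filtration M) : Prop :=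
  exists n0 : int, forall n : int, n0 <= n -> ideal_mul a (G n) =i G (n + 1).

(* [a ^ n], with [a ^ n = A] for [n <= 0]. *)
Definition adic_pow (n : int) : {pred A^o} :=
  if n is Posz k then ideal_pow a k else predT.

Lemma adic_submod n : submod_closed (adic_pow n).
Proof.
by case: n => [[|k]|k] /=; [split| exact: ideal_mul_submod | split].
Qed.

Lemma adic_mul n : {subset ideal_mul a (adic_pow n) <= adic_pow (n + 1)}.
Proof.
case: n => [k|[|k]] x xa //.
by rewrite -PoszD addn1.
Qed.

Lemma adic_dec n : {subset adic_pow (n + 1) <= adic_pow n}.
Proof.
case: n => [k|k] //; rewrite -PoszD addn1 /=.
elim: k => [|k IHk] //.
apply: ideal_mul_sub; first exact: (adic_submod (Posz k.+1)).
by move=> r x ra /IHk xk; apply: mem_ideal_mul.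
Qed.

Lemma adic_exhaustive :
  exists n0 : int, forall n : int, n <= n0 -> adic_pow n =i predT.
Proof. by exists 0 => -[[|k]|k]. Qed.

Definition adic : filtration A^o :=
  Filtration adic_submod adic_dec adic_exhaustive adic_mul.

Variables (M : lmodType A) (G : filtration M).

HB.instance Definition _ n :=
  GRing.isSubmodClosed.Build A M (fil G n) (fil_submod G n).

Lemma fil_le (n : int) (k : nat) : {subset G (n + k%:Z) <= G n}.
Proof.
elim: k => [|k IHk] x; first by rewrite addr0.
by rewrite -addn1 PoszD addrA => /fil_dec /IHk.
Qed.

Lemma adic_fil i j r x : r \in adic i -> x \in G j -> r *: x \in G (i + j).
Proof.
case: i => [k|k] /=.
  elim: k r x => [|k IHk] r x; first by rewrite add0r => _; apply: rpredZ.
  move=> + xj.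
  apply: (@ideal_mul_sub A A^o a (ideal_pow a k)
            [pred r : A^o | r *: x \in G (Posz k.+1 + j)]).
    split; rewrite ?inE ?scale0r ?rpred0 // => c u v; rewrite !inE => uG vG.
    by rewrite scalerDl rpredD // -scalerA rpredZ.
  move=> b c ba ck; rewrite inE -scalerA -addn1 PoszD addrAC.
  by apply: fil_mul; apply: mem_ideal_mul => //; apply: IHk.
move=> _ xj; apply: rpredZ; apply: (@fil_le _ k.+1).
by rewrite NegzE addrAC addNr add0r.
Qed.

End Filtrations.

Section Finite_support.

Definition finsupport (V : zmodType) (u : int -> V) : Prop :=
  finite_set (u @^-1` [set~ 0]).

Lemma finsupportP (V : zmodType) (u : int -> V) :
  finsupport u <-> exists X : {fset int}, forall n, n \notin X -> u n = 0.
Proof.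
split=> [/finite_fsetP [X uX]|[X uX]].
  exists X => n; apply: contraNeq => /eqP un.
  by have : [set` X] n by rewrite -uX.
apply: (finite_subfset X) => n /= un.
by apply: contraPT un => /uX ->.
Qed.

Lemma finsupport0 (V : zmodType) : finsupport (0 : int -> V).
Proof. by apply/finsupportP; exists fset0. Qed.

Lemma finsupportB (V : zmodType) (u v : int -> V) :
  finsupport u -> finsupport v -> finsupport (u - v).
Proof.
move=> /finsupportP [X uX] /finsupportP [Y vY]; apply/finsupportP.
exists (X `|` Y)%fset => n; rewrite inE negb_or => /andP [nX nY].
by rewrite !fctE uX // vY // subr0.
Qed.

Lemma finsupportD (V : zmodType) (u v : int -> V) :
  finsupport u -> finsupport v -> finsupport (u + v).
Proof.
move=> fu fv; rewrite -[v]opprK; apply: finsupportB => //.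
by rewrite -sub0r; apply: finsupportB => //; apply: finsupport0.
Qed.

Lemma finsupport_sum (V : zmodType) (I : Type) (s : seq I) (F : I -> int -> V) :
  (forall i, finsupport (F i)) -> finsupport (\sum_(i <- s) F i).
Proof.
move=> fF; elim: s => [|i s IHs]; first by rewrite big_nil; apply: finsupport0.
by rewrite big_cons; apply: finsupportD.
Qed.

Lemma sumfctE (V : zmodType) (I T : Type) (s : seq I) (F : I -> T -> V) x :
  (\sum_(i <- s) F i) x = \sum_(i <- s) F i x.
Proof. by elim/big_rec2: _ => // i y u _ <-. Qed.

Lemma fsumD (V : zmodType) (u v : int -> V) :
  finsupport u -> finsupport v ->
  \sum_(n \in [set: int]) (u n + v n) =
  \sum_(n \in [set: int]) u n + \sum_(n \in [set: int]) v n.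
Proof.
move=> /finsupportP [X uX] /finsupportP [Y vY].
pose Z := (X `|` Y)%fset.
have uZ n : n \notin Z -> u n = 0 by rewrite inE negb_or => /andP [/uX].
have vZ n : n \notin Z -> v n = 0 by rewrite inE negb_or => /andP [_ /vY].
rewrite !(fsbigTE Z) ?big_split // => n nZ.
by rewrite uZ // vZ // addr0.
Qed.

Lemma fsum_additive (V W : zmodType) (f : {additive V -> W}) (u : int -> V) :
  finsupport u ->
  f (\sum_(n \in [set: int]) u n) = \sum_(n \in [set: int]) f (u n).
Proof.
move=> /finsupportP [X uX]; rewrite !(fsbigTE X) ?raddf_sum // => n nX.
by rewrite uX // raddf0.
Qed.

Lemma finsupport_additive (V W : zmodType) (f : {additive V -> W})
  (u : int -> V) : finsupport u -> finsupport (fun n => f (u n)).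
Proof.
move=> /finsupportP [X uX]; apply/finsupportP; exists X => n nX.
by rewrite uX // raddf0.
Qed.

Lemma finsupport_shift (V : zmodType) (u : int -> V) k :
  finsupport u -> finsupport (fun n => u (n - k)).
Proof.
move=> /finsupportP [X uX]; apply/finsupportP.
exists [fset (i + k)%R | i in X]%fset => n nX; apply: uX.
apply: contra nX => nX; apply/imfsetP; exists (n - k) => //.
by rewrite subrK.
Qed.

Lemma fsum_shift (V : zmodType) (u : int -> V) k :
  \sum_(n \in [set: int]) u (n + k) = \sum_(n \in [set: int]) u n.
Proof.
rewrite [RHS](@reindex_fsbigT _ _ _ _ _ (fun n => n + k)) //.
by apply: (@Bijective _ _ _ (fun n => n - k)) => n; rewrite ?addrK ?subrK.
Qed.

Lemma fsum_opp (V : zmodType) (u : int -> V) k :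
  \sum_(n \in [set: int]) u (k - n) = \sum_(n \in [set: int]) u n.
Proof.
rewrite [RHS](@reindex_fsbigT _ _ _ _ _ (fun n => k - n)) //.
by apply: (@Bijective _ _ _ (fun n => k - n)) => n; rewrite opprB addrC subrK.
Qed.

Lemma fsum_single (V : zmodType) (u : int -> V) k :
  (forall n, n != k -> u n = 0) -> \sum_(n \in [set: int]) u n = u k.
Proof.
move=> uk; rewrite (fsbigTE [fset k]%fset) ?big_seq_fset1 // => n.
by rewrite inE => /uk.
Qed.

Lemma finsupport_single (V : zmodType) (u : int -> V) k :
  (forall n, n != k -> u n = 0) -> finsupport u.
Proof. by move=> uk; apply/finsupportP; exists [fset k]%fset => n; rewrite inE => /uk. Qed.

End Finite_support.

(* The product of the Laurent expansions [\sum_i r i t^i] and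
   [\sum_j u j t^j], used for finitely supported [r] and [u]. *)
Section Convolution.
Variables (A : comNzRingType) (M : lmodType A).
Implicit Types (r s : int -> A^o) (u v : int -> M).

Definition conv r u : int -> M :=
  fun n => \sum_(i \in [set: int]) r i *: u (n - i).

Let shift (k : int) u : int -> M := fun n => u (n - k).

Lemma convE r u (X : {fset int}) : (forall n, n \notin X -> r n = 0) ->
  conv r u = \sum_(i <- X) (fun n => r i *: u (n - i)).
Proof.
move=> rX; apply: funext => n; rewrite /conv sumfctE (fsbigTE X) // => i iX.
by rewrite rX // scale0r.
Qed.

Lemma convDl r s u : finsupport r -> finsupport s ->
  conv (r + s) u = conv r u + conv s u.
Proof.
move=> fr fs; apply: funext => n; rewrite /conv !fctE.
under eq_fsbigr do rewrite scalerDl.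
have fz (q : int -> A^o) : finsupport q -> finsupport (fun i => q i *: u (n - i)).
  move=> /finsupportP [X qX]; apply/finsupportP; exists X => i iX.
  by rewrite qX // scale0r.
by rewrite fsumD //; apply: fz.
Qed.

Lemma convDr r u v : finsupport r -> conv r (u + v) = conv r u + conv r v.
Proof.
move=> /finsupportP [X rX]; rewrite !(convE _ rX) -big_split.
by apply: eq_bigr => i _; apply: funext => n; rewrite !fctE scalerDr.
Qed.

Lemma conv_suml (I : Type) (t : seq I) (F : I -> int -> A^o) u :
  (forall i, finsupport (F i)) ->
  conv (\sum_(i <- t) F i) u = \sum_(i <- t) conv (F i) u.
Proof.
move=> fF; elim: t => [|i t IHt].
  rewrite !big_nil; apply: funext => n; apply: fsbig1 => i _.
  exact: scale0r.
by rewrite !big_cons convDl ?IHt //; apply: finsupport_sum.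
Qed.

Lemma conv_shift (c : A) k s u : finsupport s ->
  conv (fun n => c *: s (n - k)) u = (fun n => c *: conv s u (n - k)).
Proof.
move=> fs; apply: funext => n; rewrite /conv.
rewrite -(@fsum_shift _ _ k) (fsum_additive (GRing.scale c)); last first.
  move/finsupportP: fs => [X sX]; apply/finsupportP; exists X => i iX.
  by rewrite sX // scale0r.
apply: eq_fsbigr => i _ /=; rewrite addrK opprD addrA addrAC; exact/esym/scalerA.
Qed.

Lemma conv_finsupport r u : finsupport r -> finsupport u ->
  finsupport (conv r u).
Proof.
move=> /finsupportP [X rX] fu; rewrite (convE _ rX).
apply: finsupport_sum => i.
by apply: (finsupport_additive (GRing.scale (r i))); apply: finsupport_shift.
Qed.

Definition delta0 : int -> A^o := fun n => (n == 0)%:R.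

Lemma delta0_finsupport : finsupport delta0.
Proof. by apply: (@finsupport_single _ _ 0) => n /negPf; rewrite /delta0 => ->. Qed.

Lemma conv1r u : conv delta0 u = u.
Proof.
apply: funext => n; rewrite /conv (@fsum_single _ _ 0) /delta0.
  by rewrite eqxx scale1r subr0.
by move=> i /negPf ->; rewrite scale0r.
Qed.

End Convolution.

Lemma convA (A : comNzRingType) (M : lmodType A) (r s : int -> A^o)
    (u : int -> M) : finsupport r -> finsupport s ->
  conv r (conv s u) = conv (conv r s) u.
Proof.
move=> /finsupportP [X rX] fs; rewrite !(convE _ rX) conv_suml.
  by apply: eq_bigr => i _; rewrite conv_shift.
by move=> i; apply: (finsupport_additive (GRing.scale (r i : A)));
  apply: finsupport_shift.
Qed.

Lemma convC (A : comNzRingType) (r s : int -> A^o) : conv r s = conv s r.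
Proof.
apply: funext => n; rewrite /conv -(fsum_opp _ n).
by apply: eq_fsbigr => i _; rewrite subKr [LHS]mulrC.
Qed.

(* [V] is the internal direct sum of the subgroups [homog n]. *)
HB.mixin Record Zmodule_isGraded V of GRing.Zmodule V := {
  homog : int -> {pred V};
  homog_zmod : forall n, zmod_closed (homog n);
  homog_decomp : forall v : V, exists! u : int -> V,
    [/\ finsupport u, forall n, u n \in homog n
      & v = \sum_(n \in [set: int]) u n]
}.

#[short(type="gradedZmodType")]
HB.structure Definition GradedZmodule :=
  {V of Zmodule_isGraded V & GRing.Zmodule V}.

Arguments homog {s} n : rename.

HB.mixin Record GradedZmodule_isGradedComNzRing R
    of GRing.ComNzRing R & GradedZmodule R := {
  homog1 : (1 : R) \in homog 0;
  homogM : forall (m n : int) (x y : R),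
    x \in homog m -> y \in homog n -> x * y \in homog (m + n)
}.

#[short(type="gradedComNzRingType")]
HB.structure Definition GradedComNzRing :=
  {R of GradedZmodule_isGradedComNzRing R & GRing.ComNzRing R
      & GradedZmodule R}.

HB.mixin Record GradedZmodule_isGradedLmodule (R : gradedComNzRingType) V
    of GRing.Lmodule R V & GradedZmodule V := {
  homogZ : forall (m n : int) (r : R) (v : V),
    r \in homog m -> v \in homog n -> r *: v \in homog (m + n)
}.

#[short(type="gradedLmodType")]
HB.structure Definition GradedLmodule (R : gradedComNzRingType) :=
  {V of GradedZmodule_isGradedLmodule R V & GRing.Lmodule R V
      & GradedZmodule V}.

HB.instance Definition _ (V : gradedZmodType) n :=
  GRing.isZmodClosed.Build V (@homog V n) (homog_zmod n).

HB.instance Definition _ (R : gradedComNzRingType) :=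
  Zmodule_isGraded.Build R^o (@homog_zmod R) (@homog_decomp R).

HB.instance Definition _ (R : gradedComNzRingType) :=
  GradedZmodule_isGradedLmodule.Build R R^o (@homogM R).

Definition graded_iso (R : gradedComNzRingType) (U V : gradedLmodType R)
    : Prop :=
  exists f : {linear U -> V},
    bijective f /\
    forall (n : int) (u : U), (f u \in homog n) = (u \in homog n).

Section Rees.
Variables (A : comNzRingType) (a : ideal A) (M : lmodType A).
Variable G : filtration a M.

Definition rees_pred : {pred int -> M} :=
  [pred u | `[< finsupport u /\ forall n, u n \in G n >] ].

Lemma rees_predP u :
  reflect (finsupport u /\ forall n, u n \in G n) (u \in rees_pred).
Proof. by rewrite inE; apply: asboolP. Qed.

Lemma rees_zmod : zmod_closed rees_pred.
Proof.
split=> [|u v].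
  by apply/rees_predP; split=> [|n]; [exact: finsupport0 | exact: rpred0].
move=> /rees_predP [fu uG] /rees_predP [fv vG]; apply/rees_predP.
by split=> [|n]; [exact: finsupportB | rewrite !fctE rpredB].
Qed.

HB.instance Definition _ := GRing.isZmodClosed.Build _ rees_pred rees_zmod.

(* The element [\sum_n (u n) t^n] is represented by its coefficients [u]. *)
Record rees := Rees { rees_coef :> int -> M; _ : rees_coef \in rees_pred }.

HB.instance Definition _ := [isSub for rees_coef].
HB.instance Definition _ := [Choice of rees by <:].
HB.instance Definition _ := [SubChoice_isSubZmodule of rees by <:].

Lemma rees_finsupport (u : rees) : finsupport u.
Proof. by have /rees_predP [] := valP u. Qed.

Lemma rees_fil (u : rees) n : u n \in G n.
Proof. by have /rees_predP [] := valP u. Qed.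

Lemma reesP (u v : rees) : (forall n, u n = v n) -> u = v.
Proof. by move=> uv; apply/val_inj/funext. Qed.

Definition rees_homog (n : int) : {pred rees} :=
  [pred u : rees | `[< forall k, k != n -> u k = 0 >] ].

Lemma rees_homogP n (u : rees) :
  reflect (forall k, k != n -> u k = 0) (u \in rees_homog n).
Proof. by rewrite inE; apply: asboolP. Qed.

Lemma rees_homog_zmod n : zmod_closed (rees_homog n).
Proof.
split=> [|u v]; first by apply/rees_homogP.
move=> /rees_homogP un /rees_homogP vn; apply/rees_homogP => k kn.
by rewrite -[LHS]/(u k - v k) un // vn // subr0.
Qed.

Definition rees_ev (k : int) (u : rees) : M := u k.

Lemma rees_ev_zmod k : zmod_morphism (rees_ev k).
Proof. by []. Qed.

HB.instance Definition _ k :=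
  GRing.isZmodMorphism.Build rees M (rees_ev k) (rees_ev_zmod k).

Lemma rees_comp_subproof (u : rees) (n : int) :
  (fun k : int => if k == n then u k else 0) \in rees_pred.
Proof.
apply/rees_predP; split=> [|k].
  by apply: (@finsupport_single _ _ n) => k /negPf ->.
by case: eqP => _; [exact: rees_fil | exact: rpred0].
Qed.

Definition rees_comp u n := Rees (rees_comp_subproof u n).

Lemma rees_decomp (u : rees) : exists! w : int -> rees,
  [/\ finsupport w, forall n, w n \in rees_homog n
    & u = \sum_(n \in [set: int]) w n].
Proof.
have ev (w : int -> rees) k : finsupport w -> (forall n, w n \in rees_homog n) ->
    (\sum_(n \in [set: int]) w n) k = w k k.
  move=> fw wn; rewrite -[LHS]/(rees_ev k _) fsum_additive //.
  rewrite (@fsum_single _ _ k) // => n nk.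
  by move/rees_homogP: (wn n); apply; rewrite eq_sym.
have fc : finsupport (rees_comp u).
  have /finsupportP [X uX] := rees_finsupport u.
  apply/finsupportP; exists X => n nX; apply: reesP => k /=.
  by case: eqP => // ->; apply: uX.
have hc n : rees_comp u n \in rees_homog n.
  by apply/rees_homogP => k /negPf /= ->.
exists (rees_comp u); split.
  by split=> //; apply: reesP => k; rewrite ev //= eqxx.
move=> w [fw hw uE]; apply: funext => n; apply: reesP => k /=.
have [->|kn] := eqVneq k n; first by rewrite uE ev.
by move/rees_homogP: (hw n) => ->.
Qed.

HB.instance Definition _ :=
  Zmodule_isGraded.Build rees rees_homog_zmod rees_decomp.

End Rees.

Arguments rees_homogP {A a M G n u}.

Section Extended_rees_algebra.
Variables (A : comNzRingType) (a : ideal A).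

(* The extended Rees algebra [A[at, t^-1]] is the extended Rees module of the
   adic filtration on [A], with the product of Laurent polynomials. *)
Definition rees_alg := rees (adic a).

HB.instance Definition _ := GradedZmodule.on rees_alg.

Section Scale.
Variables (M : lmodType A) (G : filtration a M).

Lemma rees_scale_subproof (r : rees_alg) (u : rees G) :
  conv (rees_coef r) (rees_coef u) \in rees_pred G.
Proof.
apply/rees_predP; split=> [|n].
  by apply: conv_finsupport; apply: rees_finsupport.
have /finsupportP [X rX] := rees_finsupport r.
rewrite (convE _ rX) sumfctE; apply: rpred_sum => i _.
by have := adic_fil (rees_fil r i) (rees_fil u (n - i)); rewrite subrKC.
Qed.

Definition rees_scale r u := Rees (rees_scale_subproof r u).

End Scale.

Lemma rees_one_subproof : delta0 A \in rees_pred (adic a).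
Proof.
apply/rees_predP; split=> [|n]; first exact: delta0_finsupport.
by rewrite /delta0; case: eqP => [->|_] //; exact: rpred0.
Qed.

Definition rees_one : rees_alg := Rees rees_one_subproof.

Definition rees_mul (r s : rees_alg) : rees_alg := rees_scale r s.

Lemma rees_mulA : associative rees_mul.
Proof.
by move=> r s u; apply/val_inj/convA; apply: rees_finsupport.
Qed.

Lemma rees_mulC : commutative rees_mul.
Proof. by move=> r s; apply/val_inj/convC. Qed.

Lemma rees_mul1 : left_id rees_one rees_mul.
Proof. by move=> r; apply/val_inj/conv1r. Qed.

Lemma rees_mulDl : left_distributive rees_mul +%R.
Proof.
by move=> r s u; apply/val_inj/convDl; apply: rees_finsupport.
Qed.

Lemma rees_one_neq0 : rees_one != 0.
Proof.
apply/eqP => /(congr1 (fun u : rees_alg => u 0)) /= /eqP.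
by rewrite /delta0 eqxx oner_eq0.
Qed.

HB.instance Definition _ := GRing.Zmodule_isComNzRing.Build rees_alg
  rees_mulA rees_mulC rees_mul1 rees_mulDl rees_one_neq0.

Section Rees_module.
Variables (M : lmodType A) (G : filtration a M).

Lemma rees_scaleA (r s : rees_alg) (u : rees G) :
  rees_scale r (rees_scale s u) = rees_scale (r * s) u.
Proof. by apply/val_inj/convA; apply: rees_finsupport. Qed.

Lemma rees_scale1 : left_id 1 (@rees_scale M G).
Proof. by move=> u; apply/val_inj/conv1r. Qed.

Lemma rees_scaleDr : right_distributive (@rees_scale M G) +%R.
Proof. by move=> r u v; apply/val_inj/convDr; apply: rees_finsupport. Qed.

Lemma rees_scaleDl (u : rees G) :
  {morph (@rees_scale M G)^~ u : r s / r + s}.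
Proof. by move=> r s; apply/val_inj/convDl; apply: rees_finsupport. Qed.

HB.instance Definition _ := GRing.Zmodule_isLmodule.Build rees_alg (rees G)
  rees_scaleA rees_scale1 rees_scaleDr rees_scaleDl.

Lemma rees_homogZ m n (r : rees_alg) (u : rees G) :
  r \in homog m -> u \in homog n -> rees_scale r u \in homog (m + n).
Proof.
move=> /rees_homogP rm /rees_homogP un; apply/rees_homogP => k kmn /=.
apply: fsbig1 => i _.
have [-> |im] := eqVneq i m; last by rewrite rm // scale0r.
rewrite un ?scaler0 //; apply: contra kmn => /eqP <-.
by rewrite subrKC.
Qed.

End Rees_module.

Lemma rees_homog1 : (1 : rees_alg) \in homog 0.
Proof. by apply/rees_homogP => k /negPf /=; rewrite /delta0 => ->. Qed.

HB.instance Definition _ := GradedZmodule_isGradedComNzRing.Build rees_alg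
  rees_homog1 (@rees_homogZ A^o (adic a)).

HB.instance Definition _ (M : lmodType A) (G : filtration a M) :=
  GradedZmodule_isGradedLmodule.Build rees_alg (rees G) (@rees_homogZ M G).

End Extended_rees_algebra.

Section Hom.
Variables (R : comNzRingType) (U V : lmodType R).

Definition linear_pred : {pred U -> V} := [pred f | `[< linear f >] ].

Lemma linear_predP f : reflect (linear f) (f \in linear_pred).
Proof. by rewrite inE; apply: asboolP. Qed.

Lemma linear_submod : submod_closed linear_pred.
Proof.
split=> [|c f g].
  by apply/linear_predP => r x y; rewrite scaler0 addr0.
move=> /linear_predP fL /linear_predP gL; apply/linear_predP => r x y.
rewrite !fctE fL gL !scalerDr !scalerA [c * r]mulrC -!addrA; congr (_ + _).
by rewrite [RHS]addrCA.
Qed.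

HB.instance Definition _ :=
  GRing.isSubmodClosed.Build R _ linear_pred linear_submod.

Record hom_mod := HomMod { hom_fun :> U -> V; _ : hom_fun \in linear_pred }.

HB.instance Definition _ := [isSub for hom_fun].
HB.instance Definition _ := [Choice of hom_mod by <:].
HB.instance Definition _ := [SubChoice_isSubLmodule of hom_mod by <:].

Lemma hom_fun_linear (f : hom_mod) : linear f.
Proof. exact/linear_predP/(valP f). Qed.

HB.instance Definition _ (f : hom_mod) :=
  GRing.isLinear.Build R U V *:%R (hom_fun f) (hom_fun_linear f).

Lemma hom_modP (f g : hom_mod) : f =1 g -> f = g.
Proof. by move=> fg; apply/val_inj/funext. Qed.

End Hom.

Definition dual (A : comNzRingType) (M : lmodType A) := hom_mod M A^o.

HB.instance Definition _ (A : comNzRingType) (M : lmodType A) :=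
  GRing.Lmodule.on (dual M).

Section Star_hom.
Variables (R : gradedComNzRingType) (U V : gradedLmodType R).

Definition homogeneous_map (c : int) (f : hom_mod U V) : Prop :=
  forall (n : int) (u : U), u \in homog n -> f u \in homog (n + c).

(* The sum of the groups of homogeneous maps of all degrees, formed inside
   [hom_mod U V]; it is direct by [star_hom_decomp]. *)
Definition star_pred : {pred hom_mod U V} :=
  [pred f | `[< exists g : int -> hom_mod U V,
      [/\ finsupport g, forall c, homogeneous_map c (g c)
        & f = \sum_(c \in [set: int]) g c] >] ].


Lemma star_predP f :
  reflect (exists g : int -> hom_mod U V,
      [/\ finsupport g, forall c, homogeneous_map c (g c)
        & f = \sum_(c \in [set: int]) g c]) (f \in star_pred).
Proof. by rewrite inE; apply: asboolP. Qed.

Lemma homogeneous_map0 c : homogeneous_map c 0.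
Proof. by move=> n u _; apply: (@rpred0 _ (homog (n + c))). Qed.

Lemma homogeneous_mapB c f g :
  homogeneous_map c f -> homogeneous_map c g -> homogeneous_map c (f - g).
Proof.
by move=> hf hg n u un; exact: (@rpredB _ (homog (n + c)) _ _ (hf n u un) (hg n u un)).
Qed.

Lemma homogeneous_mapZ m c r f :
  r \in homog m -> homogeneous_map c f -> homogeneous_map (m + c) (r *: f).
Proof.
by move=> rm hf n u un; rewrite addrCA; exact: (homogZ _ _ _ _ rm (hf n u un)).
Qed.

Lemma homogeneous_star c f : homogeneous_map c f -> f \in star_pred.
Proof.
move=> hf; apply/star_predP; exists (fun k => if k == c then f else 0).
split=> [|k|].
- by apply: (@finsupport_single _ _ c) => k /negPf ->.
- by case: eqP => [->|_] //; exact: homogeneous_map0.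
- by rewrite (@fsum_single _ _ c) ?eqxx // => k /negPf ->.
Qed.

Lemma star_zmod : zmod_closed star_pred.
Proof.
split; first exact: (homogeneous_star (@homogeneous_map0 0)).
move=> _ _ /star_predP [g [fg hg ->]] /star_predP [g' [fg' hg' ->]].
apply/star_predP; exists (g - g'); split=> [|c|]; first exact: finsupportB.
  by apply: homogeneous_mapB.
have fN : finsupport (- g') by rewrite -sub0r; apply: finsupportB => //; apply: finsupport0.
rewrite [RHS](fsumD fg fN); congr (_ + _).
by rewrite (fsum_additive -%R).
Qed.

HB.instance Definition _ := GRing.isZmodClosed.Build _ star_pred star_zmod.

Lemma star_scale : scaler_closed star_pred.
Proof.
move=> r _ /star_predP [g [fg hg ->]].
have [w [[/finsupportP [X wX] hw ->] _]] := homog_decomp r.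
rewrite (fsbigTE X) // scaler_suml; apply: rpred_sum => m _.
have /finsupportP [Y gY] := fg.
rewrite (fsbigTE Y) // scaler_sumr; apply: rpred_sum => c _.
exact: (homogeneous_star (homogeneous_mapZ (hw m) (hg c))).
Qed.

HB.instance Definition _ := GRing.isScaleClosed.Build R _ star_pred star_scale.

Record star_hom := StarHom {
  star_map :> hom_mod U V; _ : star_map \in star_pred }.

HB.instance Definition _ := [isSub for star_map].
HB.instance Definition _ := [Choice of star_hom by <:].
HB.instance Definition _ := [SubChoice_isSubLmodule of star_hom by <:].

Definition star_homog (c : int) : {pred star_hom} :=
  [pred f : star_hom | `[< homogeneous_map c f >] ].

Lemma star_homogP c (f : star_hom) :
  reflect (homogeneous_map c f) (f \in star_homog c).
Proof. by rewrite inE; apply: asboolP. Qed.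

Lemma star_homog_zmod c : zmod_closed (star_homog c).
Proof.
split=> [|f g]; first by apply/star_homogP; exact: homogeneous_map0.
by move=> /star_homogP hf /star_homogP hg; apply/star_homogP/homogeneous_mapB.
Qed.

Definition star_ev (u : U) (f : star_hom) : V := f u.

Lemma star_ev_zmod u : zmod_morphism (star_ev u).
Proof. by []. Qed.

HB.instance Definition _ u :=
  GRing.isZmodMorphism.Build star_hom V (star_ev u) (star_ev_zmod u).

Lemma star_decomp_uniq (g g' : int -> star_hom) :
  finsupport g -> (forall c, g c \in star_homog c) ->
  finsupport g' -> (forall c, g' c \in star_homog c) ->
  \sum_(c \in [set: int]) g c = \sum_(c \in [set: int]) g' c -> g = g'.
Proof.
move=> fg hg fg' hg' gg'.
have dec (h : int -> star_hom) n u : finsupport h ->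
    (forall c, h c \in star_homog c) -> u \in homog n ->
    [/\ finsupport (fun k => h (k - n) u), forall k, h (k - n) u \in homog k
      & star_ev u (\sum_(c \in [set: int]) h c) =
        \sum_(k \in [set: int]) h (k - n) u].
  move=> fh hh un; split.
  - by apply: (finsupport_additive (star_ev u)); apply: finsupport_shift.
  - by move=> k; rewrite -[k in homog k](subrKC n); move/star_homogP: (hh (k - n)); apply.
  - by rewrite fsum_additive // -(fsum_shift _ (- n)).
have ghom c n u : u \in homog n -> g c u = g' c u.
  move=> un; have [f1 h1 e1] := dec g n u fg hg un.
  have [f2 h2 e2] := dec g' n u fg' hg' un.
  have [w [_ wU]] := homog_decomp (star_ev u (\sum_(c \in [set: int]) g c)).
  have E1 := wU _ (And3 f1 h1 e1).
  rewrite gg' in wU; have E2 := wU _ (And3 f2 h2 e2).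
  have /(congr1 (fun w => w (c + n))) := etrans (esym E1) E2.
  by rewrite !addrK.
apply: funext => c; apply/val_inj/hom_modP => u /=.
have [w [[fw hw ->] _]] := homog_decomp u.
rewrite !(fsum_additive (hom_fun _)) //.
by apply: eq_fsbigr => n _; apply: ghom (hw n).
Qed.

Lemma star_hom_decomp (f : star_hom) : exists! g : int -> star_hom,
  [/\ finsupport g, forall c, g c \in star_homog c
    & f = \sum_(c \in [set: int]) g c].
Proof.
have /star_predP [g [fg hg fE]] := valP f.
pose g' c := StarHom (homogeneous_star (hg c)).
have fg' : finsupport g'.
  have /finsupportP [X gX] := fg.
  by apply/finsupportP; exists X => n nX; apply/val_inj/gX.
have hg' c : g' c \in star_homog c by apply/star_homogP/hg.
have fE' : f = \sum_(c \in [set: int]) g' c.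
  by apply/val_inj; rewrite fsum_additive.
exists g'; split=> // h [fh hh hE].
by apply: star_decomp_uniq => //; rewrite -fE'.
Qed.

HB.instance Definition _ :=
  Zmodule_isGraded.Build star_hom star_homog_zmod star_hom_decomp.

Lemma star_homogZ m c (r : R) (f : star_hom) :
  r \in homog m -> f \in homog c -> r *: f \in homog (m + c).
Proof.
by move=> rm /star_homogP fc; apply/star_homogP/homogeneous_mapZ.
Qed.

HB.instance Definition _ :=
  GradedZmodule_isGradedLmodule.Build R star_hom star_homogZ.

End Star_hom.

Arguments star_hom {R} U V.

(* Main.v *)
(* Let [H_n] consist of the [f] in [M^*] with [f (G_j)] contained in
   [a^(n+j)] for all [j].  The Cauchy product
   [(\sum_i f_i t^i, \sum_j x_j t^j) |-> \sum_n (\sum_i f_i (x_(n-i))) t^n]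
   induces the isomorphism.  For its surjectivity, fix [j] with [G_j = M]:
   linearity over [t^-1] shows that the coefficient of [t^(n+k)] in
   [F (x t^k)] does not depend on the [k] with [x] in [G_k], hence [F] is the
   image of [\sum_n f_n t^n], where [f_n x] is the coefficient of [t^(n+j)] in
   [F (x t^j)].

   The filtration [H] is stable because its Rees module is finitely generated.
   Indeed the Rees algebra is Noetherian, by Hilbert's basis theorem, and
   evaluation at the [y_i t^j], for generators [y_i] of [M], embeds the Rees
   module of [H] in a free module of finite rank. *)

Require Import Defs.
From HB Require Import structures.
From mathcomp Require Import all_boot all_order all_algebra.
From mathcomp Require Import finmap.
From mathcomp Require Import all_classical.

Set Implicit Arguments.
Unset Strict Implicit.
Unset Printing Implicit Defensive.

Import Order.TTheory GRing.Theory Num.Theory.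

Local Open Scope ring_scope.

(** * Spans of finite families and finitely generated submodules *)

Section Span.
Variables (A : comNzRingType) (M : lmodType A).
Implicit Types (s : seq M) (P : {pred M}).

Definition lspan s : {pred M} :=
  [pred x | `[< exists c : 'I_(size s) -> A, x = \sum_i c i *: s`_i >] ].

Lemma lspanP s x :
  reflect (exists c : 'I_(size s) -> A, x = \sum_i c i *: s`_i) (x \in lspan s).
Proof. by rewrite inE; apply: asboolP. Qed.

Lemma lspan_submod s : submod_closed (lspan s).
Proof.
split; first by apply/lspanP; exists (fun=> 0); rewrite big1 // => i; rewrite scale0r.
move=> r _ _ /lspanP [c ->] /lspanP [d ->]; apply/lspanP.
exists (fun i => r * c i + d i); rewrite scaler_sumr -big_split.
by apply: eq_bigr => i _; rewrite /= scalerDl scalerA.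
Qed.

HB.instance Definition _ s :=
  GRing.isSubmodClosed.Build A M (lspan s) (lspan_submod s).

Lemma mem_lspan s : {subset s <= lspan s}.
Proof.
move=> x xs; apply/lspanP; have ltxs : (index x s < size s)%N by rewrite index_mem.
exists (fun i => (i == Ordinal ltxs)%:R); rewrite (bigD1 (Ordinal ltxs)) //=.
by rewrite eqxx scale1r nth_index // big1 ?addr0 // => i /negPf ->; rewrite scale0r.
Qed.

Lemma lspan_sub s P : submod_closed P -> {subset s <= P} -> {subset lspan s <= P}.
Proof.
move=> [P0 PL] sP x /lspanP [c ->]; apply: (big_ind (fun y => y \in P)) => //.
  by move=> y z yP zP; rewrite -[y]scale1r PL.
by move=> i _; rewrite -[_ *: _]addr0; apply: PL => //; apply/sP/mem_nth.
Qed.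

Lemma fingen_subP P : submod_closed P ->
  fingen_sub P <-> exists2 s, {subset s <= P} & {subset P <= lspan s}.
Proof.
move=> clP; split=> [[s sP]|[s sP Ps]]; exists s.
- by move=> x xs; apply/sP/lspanP/mem_lspan.
- by move=> x /sP xs; apply/lspanP.
by move=> x; split=> [/Ps/lspanP //|/lspanP]; apply: lspan_sub.
Qed.

End Span.

(** * Finite generation over a Noetherian ring *)

Lemma noetherian_fingen (A : comNzRingType) (P : {pred A^o}) :
  noetherian A -> submod_closed P -> fingen_sub P.
Proof.
move=> noethA clP.
pose I : ideal A := HB.pack P (GRing.isSubmodClosed.Build A A^o P clP).
exact: (noethA I).
Qed.

(* [phi] embeds [P] in a free module of finite rank. *)
Lemma fingen_of_functionals (A : comNzRingType) (M : lmodType A) (P : {pred M})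
    (n : nat) (phi : nat -> {linear M -> A^o}) :
  noetherian A -> submod_closed P ->
  (forall x, x \in P -> (forall k, (k < n)%N -> phi k x = 0) -> x = 0) ->
  fingen_sub P.
Proof.
move=> noethA; elim: n phi P => [|n IH] phi P clP inj.
  apply/(fingen_subP clP); exists [::] => // x xP.
  by rewrite (inj x xP) //; apply: (lspan_submod [::]).1.
pose f := phi 0%N; have [P0 PL] := clP.
(* Induction on [n]: the kernel [K] of [f] on [P] is separated by the remaining functionals, and the
   image [I] of [P] under [f] is an ideal. Generators of [K], together with lifts [v] of generators
   of [I], generate [P]. *)
pose K := [pred x | (x \in P) && (f x == 0)].
have clK : submod_closed K.
  split=> [|r x y]; rewrite !inE ?P0 ?linear0 ?eqxx //.
  move=> /andP [xP /eqP fx] /andP [yP /eqP fy].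
  by rewrite PL //= linearP fx fy scaler0 addr0.
have /(fingen_subP clK) [s sK Ks] : fingen_sub K.
  apply: (IH (phi \o S)) => // x /andP [xP /eqP fx] phix.
  apply: inj => // -[//|k].
  exact: phix.
pose I : {pred A^o} := [pred r | `[< exists2 x, x \in P & r = f x >] ].
have clI : submod_closed I.
  split=> [|r _ _ /asboolP [x xP ->] /asboolP [y yP ->]]; apply/asboolP.
    by exists 0; rewrite ?linear0.
  by exists (r *: x + y); rewrite ?PL ?linearP.
have /(fingen_subP clI) [t tI It] := noetherian_fingen noethA clI.
have [v [vP vt]] : exists v : seq M, {subset v <= P} /\ t = [seq f x | x <- v].
  elim: t tI {It} => [|r t IHt] tI; first by exists [::].
  have /asboolP [x xP ->] := tI r (mem_head _ _).
  have [|v [vP ->]] := IHt; first by move=> q qt; apply: tI; rewrite inE qt orbT.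
  exists (x :: v); split=> // y; rewrite inE => /orP [/eqP -> //|]; exact: vP.
apply/(fingen_subP clP); exists (s ++ v) => [x|x xP].
  by rewrite mem_cat => /orP [/sK /andP [] //|/vP].
have /lspanP [c fx] : f x \in lspan t by apply: It; apply/asboolP; exists x.
have szt : size t = size v by rewrite vt size_map.
(* By the choice of [c], [f y = f x], so [x - y] lies in [K]. *)
pose y := \sum_(i < size t) c i *: v`_i.
have yv : y \in lspan v.
  apply: rpred_sum => i _; apply: rpredZ; apply: mem_lspan.
  by apply: mem_nth; rewrite -szt.
have sub (u w : seq M) : {subset u <= w} -> {subset lspan u <= lspan w}.
  move=> uw; apply: lspan_sub; first exact: lspan_submod.
  by move=> z /uw; apply: mem_lspan.
rewrite -[x](subrK y) rpredD //; last first.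
  by apply: sub yv => z zv; rewrite mem_cat zv orbT.
apply: (sub s); first by move=> z zs; rewrite mem_cat zs.
apply: Ks; rewrite inE; apply/andP; split.
  by rewrite -scaleN1r addrC PL //; apply: (lspan_sub clP vP).
rewrite linearB subr_eq0 fx linear_sum; apply/eqP/eq_bigr => i _.
have -> : t`_i = f v`_i by rewrite [X in X`_i]vt (nth_map 0) // -szt.
by rewrite linearZ.
Qed.

(** * Hilbert's basis theorem *)

Section Hilbert_basis.
Variable R : comNzRingType.

Definition coef_fun (k : nat) (p : {poly R}) : R^o := p`_k.

Lemma coef_fun_linear k : linear (coef_fun k).
Proof. by move=> c p q; rewrite /coef_fun coefD coefZ. Qed.

HB.instance Definition _ k :=
  GRing.isLinear.Build R {poly R} R^o *:%R (coef_fun k) (coef_fun_linear k).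

Lemma size_XnM_leq k m (p : {poly R}) :
  (size p <= m)%N -> (size ('X^k * p)%R <= k + m)%N.
Proof.
move=> szp; apply: (leq_trans (size_polyMleq _ _)).
by rewrite size_polyXn addSn leq_add2l.
Qed.

(** Lift generators of the ideal of leading coefficients of [I] to polynomials of [I] in a common
    degree [N]. Multiples of these lower the size of any element of [I] to at most [N], and the
    elements of [I] of size at most [N] form a finitely generated [R]-module. *)
Lemma noetherian_poly : noetherian R -> noetherian {poly R}.
Proof.
move=> noethR I.
have I0 : (0 : {poly R}) \in I := rpred0 I.
have ID (p q : {poly R}) : p \in I -> q \in I -> p + q \in I := @rpredD _ I p q.
have IM (p q : {poly R}) : q \in I -> p * q \in I := @rpredZ _ _ I p q.
have IZ (c : R) (p : {poly R}) : p \in I -> c *: p \in I.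
  by rewrite -mul_polyC; apply: IM.
pose L : {pred R^o} := [pred c | `[< exists n (p : {poly R}),
  [/\ p \in I, (size p <= n.+1)%N & c = p`_n] >] ].
have clL : submod_closed L.
  split; first by apply/asboolP; exists 0%N, 0; rewrite I0 size_poly0 coef0.
  move=> r _ _ /asboolP [n [p [pI szp ->]]] /asboolP [k [q [qI szq ->]]].
  apply/asboolP; exists (n + k)%N, (r *: ('X^k * p) + 'X^n * q); split.
  - by apply: ID; [apply/IZ/IM | apply: IM].
  - apply: (leq_trans (size_polyD _ _)); rewrite geq_max; apply/andP; split.
      apply: (leq_trans (size_scale_leq _ _)).
      by rewrite addnC -addnS size_XnM_leq.
    by rewrite -addnS size_XnM_leq.
  - by rewrite coefD coefZ !coefXnM !ltnNge leq_addl leq_addr /= addnK addKn.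
have /(fingen_subP clL) [s sL Ls] := noetherian_fingen noethR clL.
have [N [t [tI tsz st]]] : exists N (t : seq {poly R}),
    [/\ {subset t <= I}, forall p, p \in t -> (size p <= N.+1)%N
      & s = map (coef_fun N) t].
  elim: s sL {Ls} => [|c s IHs] sL; first by exists 0%N, [::].
  have /asboolP [n [p [pI szp ->]]] := sL c (mem_head _ _).
  have [|N [t [tI tsz ->]]] := IHs.
    by move=> q qs; apply: sL; rewrite inE qs orbT.
  (* Multiplication by powers of ['X] brings the new lift and the old ones to the common degree
     [N + n], with the same coefficients. *)
  exists (N + n)%N, ('X^N * p :: [seq 'X^n * q | q <- t]); split.
  - move=> q; rewrite inE => /orP [/eqP ->|/mapP [q' q't ->]]; apply: IM => //.
    exact: tI.
  - move=> q; rewrite inE => /orP [/eqP ->|/mapP [q' q't ->]].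
      by rewrite -addnS size_XnM_leq.
    by rewrite addnC -addnS size_XnM_leq ?tsz.
  - rewrite /=; congr (_ :: _).
      by rewrite /coef_fun coefXnM ltnNge leq_addr addKn.
    rewrite -map_comp; apply: eq_map => q; rewrite /= /coef_fun.
    by rewrite coefXnM ltnNge leq_addl addnK.
pose P : {pred {poly R}} := [pred p | (p \in I) && (size p <= N)%N].
have clP : submod_closed P.
  split=> [|c p q]; first by rewrite inE I0 size_poly0.
  rewrite !inE => /andP [pI szp] /andP [qI szq]; rewrite ID ?IZ //=.
  apply: (leq_trans (size_polyD _ _)); rewrite geq_max szq andbT.
  exact: (leq_trans (size_scale_leq _ _)).
have /(fingen_subP clP) [u uP Pu] : fingen_sub P.
  (* The first [N] coefficients determine a polynomial of size at most [N]. *)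
  apply: (@fingen_of_functionals _ _ _ N (fun k => coef_fun k : {linear _ -> _})) => //.
  move=> p /andP [_ szp] p0; apply/polyP => k; rewrite coef0.
  have [/p0 //|Nk] := ltnP k N; exact: (nth_default _ (leq_trans szp Nk)).
apply/(fingen_subP (GRing.submodClosedP I)).
exists (t ++ u) => [p|p pI].
  by rewrite mem_cat => /orP [/tI //|/uP /andP []].
have [n] := ubnP (size p); elim: n p pI => // n IHn p pI /ltnSE szp.
pose W := @lspan _ {poly R}^o (t ++ u).
have WZ (r q : {poly R}) : q \in t ++ u -> r * q \in W.
  by move=> qtu; apply: (@rpredZ _ _ W); apply: (@mem_lspan _ {poly R}^o).
have Wsum := @rpred_sum _ W.
have [ltNp|leNp] := ltnP N (size p); last first.
  have /lspanP [c ->] : p \in lspan u by apply: Pu; rewrite inE pI.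
  apply: Wsum => i _; rewrite -mul_polyC.
  by apply: WZ; rewrite mem_cat mem_nth ?orbT.
have /lspanP [c pE] : p`_(size p).-1 \in lspan s.
  by apply: Ls; apply/asboolP; exists (size p).-1, p; rewrite prednK ?(leq_ltn_trans _ ltNp).
have szs : size s = size t by rewrite st size_map.
(* The power of ['X] moves degree [N] to the degree of [p]. Since the [t]_i[have coefficients]s[_i]
   in degree [N], [q] has the leading coefficient of [p], and [p - q] is smaller than [p]. *)
pose q : {poly R} := 'X^((size p).-1 - N) * \sum_(i < size s) c i *: t`_i.
have tI' (i : 'I_(size s)) : t`_i \in t by rewrite mem_nth // -szs.
have qW : q \in W.
  rewrite /q mulr_sumr; apply: Wsum => i _; rewrite -mul_polyC mulrA.
  by apply: WZ; rewrite mem_cat tI'.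
have qI : q \in I.
  by apply: IM; apply: (@rpred_sum _ I) => i _; apply/IZ/tI.
have p0 : (0 < size p)%N := leq_ltn_trans (leq0n _) ltNp.
have leNp : (N <= (size p).-1)%N by rewrite -ltnS prednK.
have szq : (size q <= size p)%N.
  rewrite -[leqRHS](prednK p0) -[X in (_ <= X.+1)%N](subnK leNp) -addnS size_XnM_leq //.
  apply: (leq_trans (size_sum _ _ _)); apply/bigmax_leqP => i _.
  by apply: (leq_trans (size_scale_leq _ _)); apply/tsz.
rewrite -[p](subrK q); apply: (@rpredD _ W) => //.
apply: IHn; first by apply: ID => //; rewrite -scaleN1r; apply: IZ.
suff : (size (p - q)%R < size p)%N by move/leq_trans; apply.
rewrite -[X in (_ < X)%N](prednK p0) ltnS; apply/leq_sizeP => k.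
rewrite leq_eqVlt => /orP [/eqP <-|ltk].
  rewrite coefB pE /q coefXnM ltnNge leq_subr /= subKn //.
  rewrite coef_sum -sumrB big1 // => i _.
  by rewrite coefZ [X in X`_i]st (nth_map 0) -?szs // subrr.
by rewrite coefB !nth_default ?subrr // ?(leq_trans szq) // -(prednK p0).
Qed.

End Hilbert_basis.

(** * Noetherian rings under quotients and finitely generated extensions *)

Lemma noetherian_surj (R S : comNzRingType) (f : {rmorphism R -> S}) :
  (forall y, exists x, f x = y) -> noetherian R -> noetherian S.
Proof.
move=> surjf noethR I.
have clI : @submod_closed _ S^o I := GRing.submodClosedP I.
(* Since [f] is onto, the images of generators of the preimage of [I] generate [I]. *)
pose P : {pred R^o} := [pred x : R | f x \in I].
have clP : submod_closed P.
  split=> [|r x y]; rewrite !inE; first by rewrite rmorph0 clI.1.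
  by move=> xP yP; rewrite rmorphD rmorphM; apply: clI.2.
have /(fingen_subP clP) [s sP Ps] := noetherian_fingen noethR clP.
apply/(fingen_subP clI); exists (map f s) => [y /mapP [x /sP xs ->] //|y].
have [x <-] := surjf y => xI.
have /lspanP [c ->] : x \in lspan s by apply: Ps.
rewrite rmorph_sum; apply: (@rpred_sum _ (@lspan _ S^o _)) => i _.
rewrite rmorphM; apply: (@rpredZ _ _ (@lspan _ S^o _)).
by apply: (@mem_lspan _ S^o); apply/map_f/mem_nth.
Qed.

(** Each generator is absorbed into the base by replacing [B] with [{poly B}]; once none is left,
    [f] is onto. Generation is phrased through subrings, so that elements of [T] need not be written
    as polynomials in [s]. *)
Lemma noetherian_adjoin (B T : comNzRingType) (f : {rmorphism B -> T})
    (s : seq T) :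
  noetherian B ->
  (forall P : {pred T}, subring_closed P -> (forall b, f b \in P) ->
    {subset s <= P} -> forall t, t \in P) ->
  noetherian T.
Proof.
elim: s B f => [|y s IHs] B f noethB genT.
  apply: (noetherian_surj _ noethB) => y; apply/asboolP.
  apply: (genT [pred y | `[< exists x, f x = y >] ]) => //.
    split=> [|_ _ /asboolP [x <-] /asboolP [z <-]|_ _ /asboolP [x <-] /asboolP [z <-]].
    - by apply/asboolP; exists 1; rewrite rmorph1.
    - by apply/asboolP; exists (x - z); rewrite rmorphB.
    - by apply/asboolP; exists (x * z); rewrite rmorphM.
  by move=> b; apply/asboolP; exists b.
have cfy : commr_rmorph f y by move=> x; apply: mulrC.
(* The new structure map sends ['X] to [y] and extends [f]. *)
apply: (IHs {poly B} (horner_morph cfy)); first exact: noetherian_poly.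
move=> P clP fP sP; apply: genT => // [b|x].
  by rewrite -(horner_morphC cfy); apply: fP.
rewrite inE => /orP [/eqP ->|/sP //].
by rewrite -(horner_morphX cfy); apply: fP.
Qed.

(** * The extended Rees algebra is Noetherian *)

Section Rees_noetherian.
Variables (A : comNzRingType) (a : ideal A).

Lemma rees_mono_subproof (M : lmodType A) (G : filtration a M) n x :
  x \in G n -> (fun k : int => if k == n then x else 0) \in rees_pred G.
Proof.
move=> xG; apply/rees_predP; split=> [|k].
  by apply: (@finsupport_single _ _ n) => k /negPf ->.
by case: eqP => [->|_]; [exact: xG | exact: rpred0].
Qed.

(* The element [x t^n] of the extended Rees module. *)
Definition rees_mono (M : lmodType A) (G : filtration a M) n x (xG : x \in G n)
  : rees G := Rees (rees_mono_subproof xG).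

Lemma rees_sum (M : lmodType A) (G : filtration a M) (u : rees G) :
  exists X : {fset int}, u = \sum_(n <- X) rees_mono (rees_fil u n).
Proof.
have /finsupportP [X uX] := rees_finsupport u.
exists X; apply: reesP => k; rewrite -[RHS]/(rees_ev k _) raddf_sum.
rewrite /rees_ev /=.
have [kX|kX] := boolP (k \in X).
  rewrite (big_fsetD1 k) //= eqxx big_seq big1 ?addr0 // => n.
  by rewrite !inE eq_sym => /andP [/negPf ->].
rewrite uX // big_seq big1 // => n nX; case: eqP kX => // ->.
by rewrite nX.
Qed.

Lemma rees_monoZ (M : lmodType A) (G : filtration a M) n (r : A)
    (ra : r \in adic a n) (u : rees G) k :
  ((rees_mono ra : rees_alg a) *: u) k = r *: u (k - n).
Proof.
rewrite -[LHS]/(conv _ _ k) /conv (@fsum_single _ _ n) /= ?eqxx //.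
by move=> i /negPf ->; rewrite scale0r.
Qed.

Lemma rees_const_subproof (c : A) : c \in adic a 0. Proof. by []. Qed.

Definition rees_const c : rees_alg a := rees_mono (rees_const_subproof c).

Lemma rees_const_zmod : zmod_morphism rees_const.
Proof.
move=> c d; apply: reesP => k.
rewrite -[RHS]/(rees_const c k - rees_const d k) /=.
by case: eqP; rewrite ?subr0.
Qed.

Lemma rees_const_monoid : monoid_morphism rees_const.
Proof.
split=> [|c d]; first by apply: reesP => k /=; rewrite /delta0; case: eqP.
apply: reesP => k.
rewrite [RHS](rees_monoZ (rees_const_subproof c) (rees_const d)) /= subr0.
by case: eqP; rewrite ?scaler0.
Qed.

HB.instance Definition _ :=
  GRing.isZmodMorphism.Build A (rees_alg a) rees_const rees_const_zmod.
HB.instance Definition _ :=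
  GRing.isMonoidMorphism.Build A (rees_alg a) rees_const rees_const_monoid.

(* [A[at, t^-1]] is generated over [A] by [t^-1] and the [b t], for [b] in a
   finite set of generators of [a]. *)
Lemma noetherian_rees : noetherian A -> noetherian (rees_alg a).
Proof.
move=> noethA; have cla : @submod_closed _ A^o a := GRing.submodClosedP a.
have /(fingen_subP cla) [b ba ab] := noethA a.
(* [s] provides the monomials [r t] for the generators [r] of [a]. They are described by
   coefficients because [rees_mono] depends on a proof of membership. *)
have [s sb] : exists s : seq (rees_alg a), forall r : A^o, r \in b ->
    exists2 u, u \in s & forall k, u k = if k == 1 then r else 0.
  elim: b ba {ab} => [|r b IHb] ba; first by exists [::].
  have [|s sb] := IHb; first by move=> q qb; apply: ba; rewrite inE qb orbT.
  have r1 : r \in adic a 1.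
    by rewrite -[r]mulr1; apply: mem_ideal_mul => //; apply/ba/mem_head.
  exists ((rees_mono r1 : rees_alg a) :: s) => q; rewrite inE.
  case/orP=> [/eqP ->|/sb [u us uE]]; first by exists (rees_mono r1); rewrite ?mem_head.
  by exists u; rewrite ?inE ?us ?orbT.
have tV : (1 : A) \in adic a (- 1) by [].
apply: (@noetherian_adjoin A _ rees_const ((rees_mono tV : rees_alg a) :: s)) => //.
move=> P clP cP sP.
have [P0 PD] := GRing.zmod_closedD (GRing.subring_closedB clP).
(* [Q n] collects the [r] with [r t^n] in the subring [P]. Every element is a finite sum of
   monomials, so it suffices that [a^n] lies in [Q n]. *)
pose Q (n : int) : {pred A^o} := [pred r | `[< exists2 u : rees_alg a,
  u \in P & forall k, u k = if k == n then r else 0 >] ].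
have QM m n (r x : A) : r \in Q m -> x \in Q n -> r * x \in Q (m + n).
  move=> /asboolP [u uP uE] /asboolP [v vP vE]; apply/asboolP.
  exists (u * v); first by case: clP => _ _; apply.
  move=> k; rewrite -[LHS]/(conv _ _ k) /conv (@fsum_single _ _ m).
    by rewrite uE vE eqxx subr_eq [n + m]addrC; case: eqP; rewrite ?scaler0.
  by move=> i /negPf im; rewrite uE im scale0r.
have Qc c : c \in Q 0 by apply/asboolP; exists (rees_const c).
have Q0 n : 0 \in Q n.
  by apply/asboolP; exists 0 => // k; case: eqP.
have QD n (r x : A) : r \in Q n -> x \in Q n -> r + x \in Q n.
  move=> /asboolP [u uP uE] /asboolP [v vP vE]; apply/asboolP.
  exists (u + v); first exact: PD.
  move=> k; rewrite -[LHS]/(u k + v k) uE vE.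
  by case: eqP; rewrite ?addr0.
have clQ n : submod_closed (Q n).
  split=> // c r x rQ xQ; apply: QD => //.
  by have := QM 0 n c r (Qc c) rQ; rewrite add0r.
have Qt (k : nat) : (1 : A) \in Q (- k%:Z).
  elim: k => [|k IHk]; first exact: Qc.
  rewrite -[1](mulr1 (1 : A)) -addn1 PoszD opprD; apply: QM IHk _.
  by apply/asboolP; exists (rees_mono tV) => //; apply/sP/mem_head.
have Qa : {subset a <= Q 1}.
  move=> r /ab; apply: lspan_sub => // {}r /sb [u us uE]; apply/asboolP.
  by exists u => //; apply: sP; rewrite inE us orbT.
have Qpow (k : nat) : {subset ideal_pow a k <= Q k}.
  elim: k => [r _|k IHk]; first exact: Qc.
  apply: ideal_mul_sub => // r x /Qa rQ /IHk xQ.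
  by rewrite -add1n PoszD; apply: QM.
have Qadic n : {subset adic a n <= Q n}.
  case: n => [k|k] r; first exact: Qpow.
  by move=> _; have := QM _ _ _ _ (Qc r) (Qt k.+1); rewrite mulr1 add0r.
move=> u; have [X ->] := rees_sum u.
apply: (big_ind (fun v => v \in P)) => // n _.
have /Qadic/asboolP [v vP vE] := rees_fil u n.
by rewrite (_ : rees_mono _ = v) //; apply: reesP => k; rewrite vE.
Qed.

End Rees_noetherian.

(** * The filtration on the dual module *)

Section Dual_filtration.
Variables (A : comNzRingType) (a : ideal A) (M : lmodType A).

Lemma dualD (f g : dual M) x : (f + g) x = f x + g x. Proof. by []. Qed.

Lemma dualZ c (f : dual M) x : (c *: f) x = c *: f x. Proof. by []. Qed.

Variable G : filtration a M.

Definition dual_fil (n : int) : {pred dual M} :=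
  [pred f : dual M | `[< forall j x, x \in G j -> f x \in adic a (n + j) >] ].

Lemma dual_filP n (f : dual M) :
  reflect (forall j x, x \in G j -> f x \in adic a (n + j)) (f \in dual_fil n).
Proof. by rewrite inE; apply: asboolP. Qed.

Lemma dual_fil_submod n : submod_closed (dual_fil n).
Proof.
split=> [|c f g]; first by apply/dual_filP => j x _; apply: (@rpred0 _ (adic a _)).
move=> /dual_filP fn /dual_filP gn; apply/dual_filP => j x xG.
rewrite dualD dualZ.
by apply: rpredD; [apply/rpredZ/fn | apply: gn].
Qed.

Lemma dual_fil_dec (n : int) : {subset dual_fil (n + 1) <= dual_fil n}.
Proof.
move=> f /dual_filP fn; apply/dual_filP => j x xG.
by apply: adic_dec; rewrite addrAC; apply: fn.
Qed.

Lemma dual_fil_mul n : {subset ideal_mul a (dual_fil n) <= dual_fil (n + 1)}.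
Proof.
apply: ideal_mul_sub; first exact: dual_fil_submod.
move=> r f ra /dual_filP fn; apply/dual_filP => j x xG.
rewrite addrAC; apply: adic_mul; rewrite dualZ.
by apply: mem_ideal_mul => //; apply: fn.
Qed.

(* Beyond the degree [s] where [G] becomes stable, [f] maps [a^k G_s] into
   [a^k]. *)
Lemma dual_fil_exhaustive : stable G ->
  exists n0 : int, forall n : int, n <= n0 -> dual_fil n =i predT.
Proof.
move=> [s stG]; exists (- s) => n ns f; apply/dual_filP => j x.
(* For [j <= s] the exponent [n + j] is at most 0, and the adic power is all of [A]. *)
have [js|sj] := leP j s.
  move=> _; have : n + j <= 0 by rewrite -(addNr s) lerD.
  by case: (n + j) => [[|k]|k].
have [k ->] : exists k : nat, j = s + k%:Z.
  by exists `|j - s|%N; rewrite gez0_abs ?subr_ge0 ?ltW // subrKC.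
have fk : {subset G (s + k%:Z) <= [pred x | f x \in adic a k]}.
  elim: k {x j sj} => [|k IHk] x //.
  rewrite -addn1 PoszD addrA -stG ?lerDl //.
  apply: ideal_mul_sub x; last first.
    move=> r x ra /IHk fx; rewrite inE linearZ.
    by apply: (@adic_mul A a k); apply: mem_ideal_mul.
  split=> [|c y z]; first by rewrite inE linear0; apply: (@rpred0 _ (adic a _)).
  rewrite !inE => fy fz; rewrite linearP.
  by apply: rpredD => //; apply: rpredZ.
(* As [n + s <= 0], [a^k] is contained in [a^(n + s + k)]. *)
move=> /fk fx; apply: (@fil_le _ _ _ (adic a) _ `|- s - n|).
by rewrite gez0_abs ?subr_ge0 // -opprD addrCA addrA addrC addrK.
Qed.

Hypothesis stG : stable G.

Definition dual_filtration : filtration a (dual M) :=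
  Filtration dual_fil_submod dual_fil_dec (dual_fil_exhaustive stG) dual_fil_mul.

End Dual_filtration.

(** * The Cauchy product of Laurent expansions over the dual and over the module *)

Section Pairing.
Variables (A : comNzRingType) (M : lmodType A).
Implicit Types (u v : int -> dual M) (x y : int -> M).

Definition pairing u x : int -> A^o :=
  fun n => \sum_(i \in [set: int]) u i (x (n - i)).

Lemma pairingE u x (X : {fset int}) n : (forall i, i \notin X -> u i = 0) ->
  pairing u x n = \sum_(i <- X) u i (x (n - i)).
Proof. by move=> uX; rewrite /pairing (fsbigTE X) // => i /uX ->. Qed.

Lemma pairingDl u v x : finsupport u -> finsupport v ->
  pairing (u + v) x = pairing u x + pairing v x.
Proof.
move=> /finsupportP [X uX] /finsupportP [Y vY]; apply: funext => n.
rewrite !fctE !(@pairingE _ _ (X `|` Y)%fset) -?big_split // => i.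
- by rewrite inE negb_or => /andP [_ /vY].
- by rewrite inE negb_or => /andP [/uX].
rewrite inE negb_or => /andP [/uX ui /vY vi].
by rewrite -[LHS]/(u i + v i) ui vi addr0.
Qed.

Lemma pairingDr u x y : finsupport u ->
  pairing u (x + y) = pairing u x + pairing u y.
Proof.
move=> /finsupportP [X uX]; apply: funext => n; rewrite !fctE !(pairingE _ _ uX).
by rewrite -big_split; apply: eq_bigr => i _; exact: (linearD (u i)).
Qed.

Lemma pairing_convr (r : int -> A^o) u x : finsupport r -> finsupport u ->
  pairing u (conv r x) = conv r (pairing u x).
Proof.
move=> /finsupportP [X rX] /finsupportP [Y uY]; apply: funext => n.
rewrite (pairingE _ _ uY) !(convE _ rX) sumfctE.
under eq_bigr do rewrite sumfctE linear_sum.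
rewrite exchange_big; apply: eq_bigr => k _ /=.
rewrite (pairingE _ _ uY) scaler_sumr; apply: eq_bigr => i _.
by rewrite linearZ addrAC.
Qed.

(** Additivity in the first argument reduces this to a single term [r k t^k], whose effect is a
    shift of the summation index by [k]. *)
Lemma pairing_convl (r : int -> A^o) u x : finsupport r -> finsupport u ->
  pairing (conv r u) x = conv r (pairing u x).
Proof.
move=> /finsupportP [X rX] fu; rewrite !(convE _ rX).
have fru k : finsupport (fun n => (r k : A) *: u (n - k)).
  by apply: (finsupport_additive (GRing.scale (r k : A))); apply: finsupport_shift.
elim: {rX} (X : seq int) => [|k s IHs].
  by rewrite !big_nil; apply: funext => n; apply: fsbig1.
rewrite !big_cons pairingDl //; last exact: finsupport_sum.
rewrite IHs; congr (_ + _); apply: funext => n.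
have /finsupportP [Y uY] := fu.
rewrite /pairing -(fsum_shift _ k) (fsum_additive (GRing.scale (r k : A))); last first.
  by apply/finsupportP; exists Y => i /uY ->.
apply: eq_fsbigr => i _ /=.
by rewrite addrK opprD addrA addrAC.
Qed.

Lemma pairing_finsupport u x : finsupport u -> finsupport x ->
  finsupport (pairing u x).
Proof.
move=> /finsupportP [X uX] fx.
have -> : pairing u x = \sum_(i <- X) (fun n => u i (x (n - i))).
  by apply: funext => n; rewrite sumfctE (pairingE _ _ uX).
apply: finsupport_sum => i.
by apply: (finsupport_additive (hom_fun (u i))); apply: finsupport_shift.
Qed.

End Pairing.

(** * The Rees module of the dual filtration as a graded Hom module *)

Lemma hom_modD (R : comNzRingType) (U V : lmodType R) (f g : hom_mod U V) x :
  (f + g) x = f x + g x.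
Proof. by []. Qed.

Lemma reesD (A : comNzRingType) (a : ideal A) (M : lmodType A)
  (G : filtration a M) (u v : rees G) n : (u + v) n = u n + v n.
Proof. by []. Qed.

Section Rees_dual.
Variables (A : comNzRingType) (a : ideal A) (M : lmodType A).
Variables (G : filtration a M) (stG : stable G).
Let H := dual_filtration stG.
Let T := rees_alg a.

Lemma rees_pairing_subproof (u : rees H) (x : rees G) :
  pairing (rees_coef u) (rees_coef x) \in rees_pred (adic a).
Proof.
apply/rees_predP; split=> [|n].
  by apply: pairing_finsupport; apply: rees_finsupport.
have /finsupportP [X uX] := rees_finsupport u.
rewrite (pairingE _ _ uX); apply: rpred_sum => i _.
by have /dual_filP /(_ _ _ (rees_fil x (n - i))) := rees_fil u i; rewrite subrKC.
Qed.

Definition rees_pairing (u : rees H) (x : rees G) : T^o :=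
  Rees (rees_pairing_subproof u x).

Lemma rees_pairing_linear u : linear (rees_pairing u).
Proof.
move=> r x y; apply/val_inj; rewrite /= -pairing_convr; last 2 first.
- exact: rees_finsupport.
- exact: rees_finsupport.
by apply: pairingDr; apply: rees_finsupport.
Qed.

Definition hom_pairing u : hom_mod (rees G) T^o :=
  HomMod (introT (linear_predP _) (rees_pairing_linear u)).

Lemma hom_pairing_linear : linear hom_pairing.
Proof.
move=> r u v; apply: hom_modP => x; apply/val_inj.
rewrite -[RHS]/(conv (rees_coef r) (pairing (rees_coef u) (rees_coef x))
  + pairing (rees_coef v) (rees_coef x)).
rewrite -pairing_convl; [|exact: rees_finsupport|exact: rees_finsupport].
by apply: pairingDl; [exact: (rees_finsupport (r *: u)) | exact: rees_finsupport].
Qed.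

HB.instance Definition _ :=
  GRing.isLinear.Build T (rees H) (hom_mod (rees G) T^o) *:%R
    hom_pairing hom_pairing_linear.

Lemma hom_pairing_homog n (u : rees H) :
  u \in homog n -> homogeneous_map n (hom_pairing u).
Proof.
move=> /rees_homogP un k x /rees_homogP xk; apply/rees_homogP => l lkn.
apply: fsbig1 => i _ /=.
have [->|/un -> //] := eqVneq i n.
by rewrite xk ?linear0 // subr_eq.
Qed.

(** [u] is a finite sum of monomials, each of which induces a homogeneous map. *)
Lemma hom_pairing_star u : hom_pairing u \in @star_pred _ (rees G) T^o.
Proof.
have [X ->] := rees_sum u; rewrite linear_sum; apply: rpred_sum => n _.
apply: (@homogeneous_star _ _ _ n); apply: hom_pairing_homog.
by apply/rees_homogP => k /negPf /= ->.
Qed.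

Definition star_pairing u : star_hom (rees G) T^o := StarHom (hom_pairing_star u).

Lemma star_pairing_linear : linear star_pairing.
Proof. by move=> r u v; apply/val_inj/hom_pairing_linear. Qed.

HB.instance Definition _ :=
  GRing.isLinear.Build T (rees H) (star_hom (rees G) T^o) *:%R
    star_pairing star_pairing_linear.

(** Monomials serve as test elements: the values on them recover every coefficient of [u]. *)
Lemma rees_pairing_mono u n x (xG : x \in G n) k :
  (rees_pairing u (rees_mono xG) : T) k = u (k - n) x.
Proof.
rewrite -[LHS]/(pairing _ _ k) /pairing (@fsum_single _ _ (k - n)) /=.
  by rewrite subKr eqxx.
by move=> i /negPf ikn; rewrite subr_eq addrC -subr_eq eq_sym ikn linear0.
Qed.

(* Multiplication by [t^-1] identifies the coefficients of the images of
   [x t^j] and [x t^k]. *)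
Lemma star_mono_coef (F : {linear rees G -> T^o}) j k x
    (xj : x \in G j) (xk : x \in G k) n :
  (F (rees_mono xj) : T) (n + j) = (F (rees_mono xk) : T) (n + k).
Proof.
(* For [j <= k], [t^(j-k)] lies in the Rees algebra and carries [x t^k] to [x t^j]. *)
wlog: j k xj xk / j <= k => [wl|jk].
  by have [/wl|/ltW /wl] := leP j k; [apply | move=> /(_ xk xj) ->].
have tV : (1 : A) \in adic a (j - k).
  move: jk; rewrite -subr_le0; by case: (j - k) => [[|l]|l].
have -> : rees_mono xj = (rees_mono tV : T) *: rees_mono xk.
  apply: reesP => l; rewrite rees_monoZ scale1r /=.
  by rewrite opprB addrA subr_eq addrC (inj_eq (addrI k)).
rewrite linearZ.
rewrite [LHS](rees_monoZ tV (F _ : rees (adic a))) scale1r.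
by rewrite opprB addrA addrAC addrK.
Qed.

Lemma fil_top : exists j, forall x, x \in G j.
Proof.
by have [j Gj] := fil_exhaustive G; exists j => x; rewrite Gj.
Qed.

Lemma rees_pairing_inj u :
  (forall x, rees_pairing u x = 0) -> u = 0.
Proof.
have [j Gj] := fil_top => u0; apply: reesP => n; apply: hom_modP => x.
by have := rees_pairing_mono u (Gj x) (n + j); rewrite u0 addrK.
Qed.

Lemma star_pairing_surj (F : star_hom (rees G) T^o) : exists u, star_pairing u = F.
Proof.
have [j Gj] := fil_top.
pose g (n : int) (x : M) : A^o := (F (rees_mono (Gj x)) : T) (n + j).
have gL n : g n \in @linear_pred _ M A^o.
  apply/linear_predP => c x y.
  (* The scalar [c] acts on the Rees module as the constant [rees_const a c], so linearity of [F]
     passes to [g n]. *)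
  have -> : g n (c *: x + y) =
      (F (rees_const a c *: rees_mono (Gj x) + rees_mono (Gj y)) : T) (n + j).
    rewrite /g; congr ((F _ : T) _); apply: reesP => k.
    rewrite -[RHS]/(((rees_const a c : T) *: rees_mono (Gj x)) k + _).
    rewrite rees_monoZ subr0 /=.
    by case: eqP; rewrite // scaler0 addr0.
  rewrite linearP -[LHS]/((rees_const a c *: (F _ : rees (adic a))) _ + _).
  by rewrite rees_monoZ subr0.
pose f n : dual M := HomMod (gL n).
(* [F] is a sum of homogeneous maps with degrees in a finite set [X], so [F (x t^j)] has no
   coefficient in degree [n + j] for [n] outside [X], whatever [x] is. *)
have fsupp : finsupport f.
  have /star_predP [h [/finsupportP [X hX] hh FE]] := valP F.
  apply/finsupportP; exists X => n nX; apply: hom_modP => x.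
  rewrite -[LHS]/((val F (rees_mono (Gj x)) : T) (n + j)).
  rewrite FE (fsbigTE X) // big_seq.
  apply: (big_ind (fun h : hom_mod (rees G) T^o => (h (rees_mono (Gj x)) : T) (n + j) = 0)).
  - by [].
  - move=> p q p0 q0.
    by rewrite hom_modD [LHS](@reesD _ _ _ (adic a)) p0 q0 addr0.
  - move=> c cX; have /hh/rees_homogP -> // : rees_mono (Gj x) \in homog j.
      by apply/rees_homogP => k /negPf /= ->.
    by rewrite addrC (inj_eq (addrI j)); apply: contraNneq nX => ->.
have fH : f \in rees_pred H.
  apply/rees_predP; split=> // n; apply/dual_filP => k x xG.
  (* For [x] in [G k], [g n x] is also the coefficient of [t^(n+k)] in [F (x t^k)], hence lies in
     [a^(n+k)]. *)
  rewrite /= /g (star_mono_coef F (Gj x) xG); exact: rees_fil.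
exists (Rees fH); apply/val_inj/hom_modP => x.
rewrite -[LHS]/(hom_pairing (Rees fH) x).
have [X ->] := rees_sum x; rewrite !linear_sum; apply: eq_bigr => n _.
apply: reesP => k; rewrite rees_pairing_mono /= /g.
by rewrite (star_mono_coef F _ (rees_fil x n)) subrK.
Qed.

Lemma star_pairing_iso : graded_iso (rees H) (star_hom (rees G) T^o).
Proof.
exists star_pairing; split.
  apply: (@Bijective _ _ _ (fun F => projT1 (cid (star_pairing_surj F)))) => [u|F].
    case: cid => /= v /eqP; rewrite -subr_eq0 -linearB => /eqP vu.
    apply/eqP; rewrite -subr_eq0; apply/eqP/rees_pairing_inj => x.
    by rewrite -[LHS]/(hom_fun (val (star_pairing (v - u))) x) vu.
  by case: cid.
move=> n u; apply/idP/idP; last first.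
  by move=> un; apply/star_homogP; apply: hom_pairing_homog.
have [j Gj] := fil_top.
(* Degrees are reflected: [u k x] is the coefficient of [t^(k+j)] in the image of [x t^j], which is
   concentrated in degree [j + n]. *)
move=> /star_homogP un; apply/rees_homogP => k kn; apply: hom_modP => x.
rewrite -[k](addrK j) -(rees_pairing_mono u (Gj x)).
have /un/rees_homogP -> // : rees_mono (Gj x) \in homog j.
  by apply/rees_homogP => l /negPf /= ->.
by rewrite addrC (inj_eq (addrI j)).
Qed.

Definition pairing_at x (u : rees H) : T^o := rees_pairing u x.

Lemma pairing_at_linear x : linear (pairing_at x).
Proof.
move=> r u v; exact: (congr1 (fun f : hom_mod _ _ => f x) (hom_pairing_linear r u v)).
Qed.

HB.instance Definition _ x :=
  GRing.isLinear.Build T (rees H) T^o *:%R (pairing_at x) (pairing_at_linear x).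

Lemma fingen_rees_dual : noetherian A -> fingen M -> @fingen T (rees H).
Proof.
move=> noethA [s Ms]; have [j Gj] := fil_top.
pose phi k : {linear rees H -> T^o} := pairing_at (rees_mono (Gj s`_k)).
apply: (fingen_of_functionals (n := size s) (phi := phi)).
- exact: noetherian_rees.
- by split.
move=> u _ u0; apply: reesP => n; apply: hom_modP => x.
(* If all the evaluations vanish on [u], each [u n] kills the generators of [M], hence all of
   [M]. *)
have /Ms [c ->] : x \in predT by [].
rewrite linear_sum; apply: big1 => i _; rewrite linearZ /=.
have -> : u n s`_i = 0; last exact: scaler0.
rewrite -[n](addrK j) -(rees_pairing_mono u (Gj s`_i)).
by rewrite -[rees_pairing _ _]/(phi i u) u0.
Qed.

End Rees_dual.

(** * Stability from finite generation of the Rees module, and the theorem *)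

Section Stable.
Variables (A : comNzRingType) (a : ideal A) (M : lmodType A).
Variable G : filtration a M.

Lemma rees_bound (s : seq (rees G)) :
  exists N : int, forall u n, u \in s -> N < n -> u n = 0.
Proof.
elim: s => [|u s [N sN]]; first by exists 0.
have /finsupportP [X uX] := rees_finsupport u.
(* The sum of the absolute values is an upper bound for every element of [X]. *)
exists (Num.max N (\sum_(i <- X) `|i|)) => v n; rewrite inE gt_max.
case/orP=> [/eqP ->|vs] /andP [Nn Xn]; last exact: sN.
apply: uX; apply: contraTN Xn => nX; rewrite -leNgt (big_fsetD1 n) //=.
by rewrite (le_trans (ler_norm n)) // lerDl sumr_ge0.
Qed.

(** Let [N] bound the degrees of the generators and let [n >= N]. To reach degree [n + 1], a
    generator's coefficient must be multiplied by a coefficient of degree [d >= 1], from which one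
    factor in [a] splits off; the rest stays in [G n]. *)
Lemma stable_of_fingen_rees : @fingen (rees_alg a) (rees G) -> stable G.
Proof.
move=> [s Gs]; have [N sN] := rees_bound s; exists N => n Nn x.
apply/idP/idP => [|xG]; first exact: fil_mul.
have [mul0 mulL] := ideal_mul_submod a (G n).
have mulD y z : y \in ideal_mul a (G n) -> z \in ideal_mul a (G n) ->
  y + z \in ideal_mul a (G n) by move=> yG; rewrite -[y]scale1r; apply: mulL.
have /Gs [c xE] : rees_mono xG \in predT by [].
have {xE} -> : x = \sum_i (c i *: s`_i) (n + 1).
  rewrite -[RHS]/(\sum_i rees_ev (n + 1) (c i *: s`_i)) -raddf_sum -xE.
  by rewrite /rees_ev /= eqxx.
apply: (big_ind (fun y => y \in ideal_mul a (G n))) => // i _.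
rewrite -[X in X \in _]/(conv (rees_coef (c i)) (rees_coef s`_i) (n + 1)).
have /finsupportP [X cX] := rees_finsupport (c i).
rewrite (convE _ cX) sumfctE.
apply: (big_ind (fun y => y \in ideal_mul a (G n))) => // d _.
(* Either the generator has no coefficient in degree [n + 1 - d], or [n + 1 - d <= N <= n] and so
   [d >= 1]. *)
have [Nd|dN] := ltP N (n + 1 - d).
  by rewrite sN ?scaler0 ?mem_nth.
have {dN} : 1 <= d by have := le_trans dN Nn; rewrite lerBlDr lerD2l.
have := rees_fil (c i) d; have := rees_fil s`_i (n + 1 - d).
case: d => [[|k]|k] //; set y := rees_coef _ _ => yG cd _.
(* Now [d = k + 1] and [c i d] lies in [a a^k]. With [y] fixed, it suffices to treat products [b r]
   with [b] in [a] and [r] in [a^k], where [r *: y] lies in [G n]. *)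
pose P := [pred r : A^o | r *: y \in ideal_mul a (G n)].
have PE (r : A) : (r \in P) = (r *: y \in ideal_mul a (G n)) by [].
apply: (ideal_mul_sub (P := P)) cd => [|b r ba rk].
  split=> [|b r t]; rewrite !PE ?scale0r // => rP tP.
  by rewrite scalerDl -scalerA; apply: mulL.
rewrite PE -scalerA; apply: mem_ideal_mul => //.
have := adic_fil (rk : r \in adic a k) yG.
by rewrite -addn1 PoszD opprD addrACA subrr addr0 subrKC.
Qed.

End Stable.

Theorem theorem1p3 (A : comNzRingType) (m : ideal A)
    (noethA : noetherian A) (localA : local_ring m) (a : ideal A)
    (M : lmodType A) (fgM : fingen M)
    (G : filtration a M) (stableG : stable G) :
  exists H : filtration a (dual M),
    stable H /\
    graded_iso (rees H) (star_hom (rees G) (rees_alg a)^o).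
Proof.
exists (dual_filtration stableG); split; last exact: star_pairing_iso.
exact/stable_of_fingen_rees/fingen_rees_dual.
Qed.
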